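(* Let $R$ be a prime (respectively, semiprime) ring, $\mathbb S=R[X^{\pm1};\boldsymbol\alpha]$ a skew Laurent polynomial ring of bijective type, $\mathcal T$ a submonoid of the free abelian group $G_X$, and $A=R[\mathcal T;\boldsymbol\alpha]=\bigoplus_{\tau\in\mathcal T}R\tau\subseteq\mathbb S$. Then $R$ is left Goldie if and only if $A$ is left Goldie; in that case $A$ is prime (respectively, semiprime) and $\operatorname{udim}(A)=\operatorname{udim}(R)$.
   Context: Skew Laurent polynomial ring of bijective type: $X$ is a set of commuting variables, $G_X$ is the free abelian group on $X$, and $\mathbb S=R[X^{\pm1};\boldsymbol\alpha]$ is the ring which is a free left $R$-module with basis $G_X$, terms multiplying as in $G_X$, and for each $x\in X$ a ring automorphism $\alpha_x$ of $R$ with $xa=\alpha_x(a)x$, $x^{-1}a=\alpha_x^{-1}(a)x^{-1}$ for $a\in R$. A ring is left Goldie if it has finite left uniform dimension and the ACC on left annihilators; $\operatorname{udim}$ is left uniform dimension. *)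

(* Defs.v *)
From HB Require Import structures.
From mathcomp Require Import all_boot all_algebra.
From mathcomp.multinomials Require Import freeg.
Set Implicit Arguments.
Unset Strict Implicit.
Unset Printing Implicit Defensive.
Import GRing.Theory.
Local Open Scope ring_scope.

Definition GX (X : choiceType) := {freeg X / int}.

Definition is_submonoid (X : choiceType) (T : GX X -> Prop) : Prop :=
  T 0 /\ (forall g h, T g -> T h -> T (g + h)).

(* S = R[X^{+-1}; alpha] : skew Laurent polynomial ring of bijective    *)
(* type.  S is a ring, iota : R -> S embeds the coefficients, mon maps  *)
(* G_X into S (the monomials), S is a free left R-module with basis     *)
(* mon(G_X), terms multiply as in G_X, and x a = alpha_x(a) x,          *)
(* x^{-1} a = alpha_x^{-1}(a) x^{-1}.                                   *)
Definition is_skew_laurent (R S : nzRingType) (X : choiceType)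
    (alpha : X -> {rmorphism R -> R}) (iota : {rmorphism R -> S})
    (mon : GX X -> S) : Prop :=
  [/\ (forall x, bijective (alpha x)),
      mon 0 = 1 /\ (forall g h, mon (g + h) = mon g * mon h),
      (forall (x : X) (a : R), mon << x >> * iota a = iota (alpha x a) * mon << x >>) /\
      (* x^{-1} a = alpha_x^{-1}(a) x^{-1}, written with b = alpha_x^{-1}(a) *)
      (forall (x : X) (b : R), mon (- << x >>) * iota (alpha x b) = iota b * mon (- << x >>)),
      (forall s : S, exists (l : seq (GX X)) (c : GX X -> R),
          s = \sum_(g <- l) iota (c g) * mon g)
    &
      (forall (l : seq (GX X)) (c : GX X -> R), uniq l ->
          \sum_(g <- l) iota (c g) * mon g = 0 -> forall g, g \in l -> c g = 0)].

Definition skew_monoid_subring (R S : nzRingType) (X : choiceType)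
    (iota : R -> S) (mon : GX X -> S) (T : GX X -> Prop) : S -> Prop :=
  fun s => exists (l : seq (GX X)) (c : GX X -> R),
      (forall g, g \in l -> T g) /\ s = \sum_(g <- l) iota (c g) * mon g.

(* Ring-theoretic notions for a (unital) subring A of a ring S, given   *)
(* as a predicate on S.  For a ring R itself use A := fun _ => True.    *)
Definition full (S : nzRingType) : S -> Prop := fun _ => True.

Definition is_prime (S : nzRingType) (A : S -> Prop) : Prop :=
  forall a b, A a -> A b -> (forall r, A r -> a * r * b = 0) -> a = 0 \/ b = 0.

Definition is_semiprime (S : nzRingType) (A : S -> Prop) : Prop :=
  forall a, A a -> (forall r, A r -> a * r * a = 0) -> a = 0.

Definition left_ideal (S : nzRingType) (A : S -> Prop) (L : S -> Prop) : Prop :=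
  [/\ (forall y, L y -> A y), L 0,
      (forall y z, L y -> L z -> L (y - z))
    & (forall a y, A a -> L y -> L (a * y))].

Definition nonzero_set (S : nzRingType) (L : S -> Prop) : Prop :=
  exists y, L y /\ y <> 0.

Definition uniform_left_ideal (S : nzRingType) (A : S -> Prop) (U : S -> Prop) : Prop :=
  [/\ left_ideal A U, nonzero_set U &
      forall L1 L2, left_ideal A L1 -> left_ideal A L2 ->
        (forall y, L1 y -> U y) -> (forall y, L2 y -> U y) ->
        nonzero_set L1 -> nonzero_set L2 ->
        nonzero_set (fun y => L1 y /\ L2 y)].

Definition independent_family (S : nzRingType) (n : nat) (U : 'I_n -> S -> Prop) : Prop :=
  forall u : 'I_n -> S, (forall i, U i (u i)) -> \sum_(i < n) u i = 0 ->
    forall i, u i = 0.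

Definition family_sum (S : nzRingType) (n : nat) (U : 'I_n -> S -> Prop) : S -> Prop :=
  fun y => exists u : 'I_n -> S, (forall i, U i (u i)) /\ y = \sum_(i < n) u i.

Definition essential_left_ideal (S : nzRingType) (A : S -> Prop) (E : S -> Prop) : Prop :=
  forall L, left_ideal A L -> nonzero_set L -> nonzero_set (fun y => L y /\ E y).

Definition has_udim (S : nzRingType) (A : S -> Prop) (n : nat) : Prop :=
  exists U : 'I_n -> S -> Prop,
    [/\ (forall i, uniform_left_ideal A (U i)),
        independent_family U
      & essential_left_ideal A (family_sum U)].

Definition finite_udim (S : nzRingType) (A : S -> Prop) : Prop :=
  exists n, has_udim A n.

Definition lann (S : nzRingType) (A : S -> Prop) (V : S -> Prop) : S -> Prop :=
  fun a => A a /\ (forall v, V v -> a * v = 0).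

Definition acc_lann (S : nzRingType) (A : S -> Prop) : Prop :=
  forall V : nat -> S -> Prop,
    (forall n y, V n y -> A y) ->
    (forall n y, lann A (V n) y -> lann A (V n.+1) y) ->
    exists N, forall n, (N <= n)%N -> forall y, lann A (V n) y -> lann A (V N) y.

Definition left_goldie (S : nzRingType) (A : S -> Prop) : Prop :=
  finite_udim A /\ acc_lann A.

(* Main.v *)
Require Import Defs.
From HB Require Import structures.
From mathcomp Require Import all_boot all_order all_algebra zify.
From mathcomp.multinomials Require Import freeg.
From Stdlib Require Import ClassicalEpsilon.
Set Implicit Arguments.
Unset Strict Implicit.
Unset Printing Implicit Defensive.
Import Order.TTheory GRing.Theory Num.Theory.
Local Open Scope ring_scope.

(* Everything is done with elements.  Call x_1, ..., x_k independent over a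
   subring B if sum b_i x_i = 0 forces every b_i x_i = 0; the uniform dimension
   is the largest number of independent elements.

   Independent elements of R stay independent over A.  Conversely let x_1, ...,
   x_k in A be independent over A; replacing x_i by an element of minimal support
   in A x_i, all coefficients of x_i have the same left annihilator, and a leading
   term argument shows that for any finite set B of monomials in T the k|B|
   elements b x_i are independent over R.  They lie in a free left R-module on
   the products of B with the supports, and since abelian groups have polynomial
   growth B can be chosen with fewer than (1 + 1/n)|B| such products.  For
   n = udim R this gives k <= n.

   A semiprime ring with the ACC on left annihilators is left nonsingular;
   nonsingularity passes from R to A by leading terms, and together with finite
   uniform dimension it gives back the ACC on left annihilators.  If c is the
   leading coefficient and tau the leading monomial of some a with aAa = 0, then
   c R alpha_tau^i(c) = 0 for all i >= 1, and the annihilators of the tails of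
   the sequence alpha_tau^i(c) stabilise only if c = 0. *)

(* freeg has a constant [lift] of its own. *)
Local Notation lift := fintype.lift.

(** * Uniform dimension through independent elements *)

Section IndependentElements.
Variables (S : nzRingType) (B : S -> Prop).

Definition subring : Prop :=
  [/\ B 1, (forall a b, B a -> B b -> B (a - b))
    & (forall a b, B a -> B b -> B (a * b))].

(** The modules [B x_i] are nonzero and their sum is direct. The [x i] may lie outside [B], so that
    elements of [S] can be counted over the image of [R]. *)
Definition independent (I : finType) (x : I -> S) : Prop :=
  (forall i, x i <> 0) /\
  (forall r : I -> S, (forall i, B (r i)) -> \sum_i r i * x i = 0 ->
     forall i, r i * x i = 0).

(* [M] has a chain of length [m] down to [0] whose factors are uniform; the
   sets in the chain need not be decreasing. *)
Fixpoint uniform_chain (m : nat) (M : S -> Prop) : Prop :=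
  if m is m'.+1 then
    exists K : S -> Prop,
      [/\ K 0, (forall r x, B r -> K x -> K (r * x)),
          (forall x y, M x -> M y -> ~ K x -> ~ K y ->
             exists r s, [/\ B r, B s, ~ K (r * x) & K (r * x - s * y)])
        & uniform_chain m' K]
  else forall x, M x -> x = 0.

Definition max_independent (n : nat) : Prop :=
  (exists x : 'I_n -> S, (forall i, B (x i)) /\ independent x) /\
  (forall k (x : 'I_k -> S), (forall i, B (x i)) -> independent x -> (k <= n)%N).

Hypothesis subringB : subring.

Lemma subring1 : B 1. Proof. by case: subringB. Qed.
Lemma subringM a b : B a -> B b -> B (a * b).
Proof. by case: subringB => _ _; apply. Qed.
Lemma subring_sub a b : B a -> B b -> B (a - b).
Proof. by case: subringB => _ h _; apply: h. Qed.
Lemma subring0 : B 0.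
Proof. by rewrite -(subrr 1); apply: subring_sub; apply: subring1. Qed.
Lemma subringN a : B a -> B (- a).
Proof. by move=> Ba; rewrite -sub0r; apply: subring_sub => //; apply: subring0. Qed.
Lemma subringD a b : B a -> B b -> B (a + b).
Proof. by move=> Ba Bb; rewrite -[b]opprK; apply: subring_sub => //; apply: subringN. Qed.
Lemma subring_sum (I : finType) (F : I -> S) :
  (forall i, B (F i)) -> B (\sum_i F i).
Proof.
by move=> BF; apply: (big_ind B) => //; [apply: subring0 | apply: subringD].
Qed.

Lemma uniform_chainS m (M M' : S -> Prop) :
  (forall x, M' x -> M x) -> uniform_chain m M -> uniform_chain m M'.
Proof.
case: m => [|m] sub /=; first by move=> h x /sub /h.
move=> [K [K0 KM ust cK]]; exists K; split=> // x y /sub Mx /sub My.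
exact: ust.
Qed.

Lemma independent_mull (I : finType) (x r : I -> S) :
    (forall i, B (r i)) -> independent x -> (forall i, r i * x i <> 0) ->
  independent (fun i => r i * x i).
Proof.
move=> Br [_ ind] nz; split=> // s Bs sum0 i.
rewrite mulrA; apply: (ind (fun i => s i * r i)) => [j|].
  exact: subringM.
by rewrite -[RHS]sum0; apply: eq_bigr => j _; rewrite mulrA.
Qed.

Lemma independent_ord (I : finType) (x : I -> S) :
  independent x -> independent (fun i : 'I_#|I| => x (enum_val i)).
Proof.
move=> [nz ind]; split=> [i|r Br sum0 i]; first exact: nz.
rewrite -{1}(enum_valK i).
apply: (ind (fun j => r (enum_rank j))) => [j|]; first exact: Br.
rewrite (reindex _ (onW_bij _ (@enum_val_bij I))) /= -[RHS]sum0.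
by apply: eq_bigr => j _; rewrite enum_valK.
Qed.

(* Gaussian elimination along the chain: a pivot [x j0] meeting the first
   factor faithfully is used to push all other elements into [K]. *)
Lemma independent_le_chain m M k (x : 'I_k -> S) :
  uniform_chain m M -> independent x -> (forall i, M (x i)) -> (k <= m)%N.
Proof.
elim: m M k x => [|m IH] M k x /=.
  case: k x => // k x h [nz _] Mx.
  by case: (nz ord0); apply: h.
move=> [K [K0 KM ust cK]] [nz ind] Mx.
(* If every [x j] has a nonzero multiple in [K], these multiples are independent and the shorter
   chain gives even [k <= m]. Otherwise some [x j0] has no nonzero multiple in [K] and serves as
   pivot. *)
case: (classic (forall j, exists r, [/\ B r, K (r * x j) & r * x j <> 0])).
  move=> /fin_all_exists [r hr]; apply: leqW; apply: (IH K k (fun i => r i * x i)) => //.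
    apply: independent_mull => // i; by case: (hr i).
  by move=> i; case: (hr i).
move=> /not_all_ex_not [j0 hj0].
have piv r : B r -> K (r * x j0) -> r * x j0 = 0.
  by move=> Br Kr; apply: NNPP => nz0; apply: hj0; exists r.
have nKj0 : ~ K (x j0).
  move=> h; apply: (nz j0); rewrite -[x j0]mul1r; apply: piv; first exact: subring1.
  by rewrite mul1r.
case: k x Mx nz ind j0 {hj0} piv nKj0 => [|k] x Mx nz ind j0 piv nKj0.
  by case: j0 piv nKj0.
have ex j : exists rs : S * S, [/\ B rs.1, B rs.2, rs.1 * x (lift j0 j) <> 0
    & K (rs.1 * x (lift j0 j) - rs.2 * x j0)].
  case: (classic (K (x (lift j0 j)))) => [Kj | nKj].
    exists (1, 0); split=> /=; [exact: subring1 | exact: subring0 | |].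
      by rewrite mul1r; apply: nz.
    by rewrite mul1r mul0r subr0.
  have [r [s [Br Bs nK Kd]]] := ust _ _ (Mx (lift j0 j)) (Mx j0) nKj nKj0.
  by exists (r, s); split=> //= h0; apply: nK; rewrite h0.
have [rs hrs] := fin_all_exists ex.
pose y j := (rs j).1 * x (lift j0 j) - (rs j).2 * x j0.
have key (t : 'I_k -> S) : (forall j, B (t j)) -> \sum_j t j * y j = 0 ->
    forall j, t j * ((rs j).1 * x (lift j0 j)) = 0.
  move=> Bt sum0 j.
  pose u i := if unlift j0 i is Some j then t j * (rs j).1
              else - \sum_j t j * (rs j).2.
  have Bu i : B (u i).
    rewrite /u; case: unliftP => [l _|_].
      by apply: subringM => //; case: (hrs l).
    by apply/subringN/subring_sum => l; apply: subringM => //; case: (hrs l).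
  have := ind u Bu _ (lift j0 j); rewrite {2}/u liftK mulrA; apply.
  rewrite (bigD1_ord j0) //= {1}/u unlift_none.
  under eq_bigr => l _ do rewrite /u liftK.
  rewrite mulNr mulr_suml addrC -sumrB -[RHS]sum0.
  by apply: eq_bigr => l _; rewrite /y mulrBr !mulrA.
rewrite ltnS; apply: (IH K k y) => //; last by move=> i; case: (hrs i).
split=> [j y0|t Bt sum0 j].
  have [_ _ nz0 _] := hrs j; apply: nz0.
  have := key (fun i => (i == j)%:R) _ _ j; rewrite eqxx mul1r; apply.
    by move=> i; case: (i == j); [apply: subring1 | apply: subring0].
  by rewrite (bigD1 j) //= eqxx mul1r y0 add0r big1 // => i /negPf->; rewrite mul0r.
(* By [key] only the pivot part of [t j * y j] survives: a multiple of [x j0] lying in [K], hence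
   zero. *)
have kj := key t Bt sum0 j.
have [Br Bs _ Kj] := hrs j.
have yE : t j * y j = - (t j * (rs j).2) * x j0.
  by rewrite /y mulrBr kj sub0r mulNr mulrA.
rewrite yE; apply: piv; first by apply/subringN/subringM.
by rewrite -yE; apply: KM.
Qed.

Lemma principal_left_ideal x : B x -> left_ideal B (fun y => exists2 b, B b & y = b * x).
Proof.
move=> Bx; split=> [y [b Bb ->]||y z [b Bb ->] [c Bc ->]|a y Ba [b Bb ->]].
- exact: subringM.
- by exists 0; [exact: subring0 | rewrite mul0r].
- by exists (b - c); [exact: subring_sub | rewrite mulrBl].
- by exists (a * b); [exact: subringM | rewrite mulrA].
Qed.

Lemma essential_mull E x : essential_left_ideal B E -> B x -> x <> 0 ->
  exists2 r, B r & r * x <> 0 /\ E (r * x).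
Proof.
move=> ess Bx nzx.
have [|y [[[b Bb ->] Ey] nz]] := ess _ (principal_left_ideal Bx).
  by exists x; split=> //; exists 1; [exact: subring1 | rewrite mul1r].
by exists b.
Qed.

Lemma uniform_mull U x y : uniform_left_ideal B U -> U x -> U y -> x <> 0 -> y <> 0 ->
  exists r s, [/\ B r, B s, r * x <> 0 & r * x = s * y].
Proof.
move=> [[UB _ _ UM] _ uni] Ux Uy nx ny.
have [||||z [[[r Br zr] [s Bs zs]] nz]] := uni _ _
  (principal_left_ideal (UB _ Ux)) (principal_left_ideal (UB _ Uy)).
- by move=> _ [b Bb ->]; apply: UM.
- by move=> _ [b Bb ->]; apply: UM.
- by exists x; split=> //; exists 1; [exact: subring1 | rewrite mul1r].
- by exists y; split=> //; exists 1; [exact: subring1 | rewrite mul1r].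
by exists r, s; split=> //; rewrite -zr.
Qed.

(** The next set of the chain drops the first summand. Two elements outside it have nonzero
    components in [U ord0]; by uniformity these have a common nonzero multiple, which cancels in the
    difference. *)
Lemma family_sum_chain n (U : 'I_n -> S -> Prop) :
  (forall i, uniform_left_ideal B (U i)) -> independent_family U ->
  uniform_chain n (family_sum U).
Proof.
elim: n U => [|n IH] U uni ind /=.
  by move=> _ [u [_ ->]]; rewrite big_ord0.
have U0 i : U i 0 by case: (uni i) => [[]].
have UM i a y : B a -> U i y -> U i (a * y) by case: (uni i) => [[_ _ _ h] _ _]; apply: h.
have Us i a b : U i a -> U i b -> U i (a - b) by case: (uni i) => [[_ _ h _] _ _]; apply: h.
pose U' i := U (lift ord0 i).
have split_ind a k : U ord0 a -> family_sum U' k -> a + k = 0 -> a = 0.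
  move=> Ua [u [Uu ->]] s0.
  pose w i := oapp u a (unlift ord0 i).
  have := ind w; rewrite big_ord_recl /w /= unlift_none /= => h.
  suff /(_ ord0) : forall i, oapp u a (unlift ord0 i) = 0 by rewrite unlift_none.
  apply: h => [i|]; first by case: unliftP => [j ->|->] //=; apply: Uu.
  by under eq_bigr => l _ do rewrite liftK.
exists (family_sum U'); split.
- by exists (fun=> 0); split=> [i|]; [exact: U0 | rewrite big1].
- move=> r x Br [u [Uu ->]]; exists (fun i => r * u i); split; last by rewrite mulr_sumr.
  by move=> i; apply: UM => //; apply: Uu.
- move=> _ _ [u [Uu ->]] [v [Uv ->]]; rewrite !big_ord_recl => nKu nKv.
  have nz (w : 'I_n.+1 -> S) : (forall i, U i (w i)) ->
      ~ family_sum U' (w ord0 + \sum_(i < n) w (lift ord0 i)) -> w ord0 <> 0.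
    move=> Uw nK w0; apply: nK; rewrite w0 add0r.
    by exists (fun i => w (lift ord0 i)); split=> // i; apply: Uw.
  have [r [s [Br Bs nzr eq_rs]]] :=
    uniform_mull (uni ord0) (Uu _) (Uv _) (nz _ Uu nKu) (nz _ Uv nKv).
  exists r, s; split=> //.
    rewrite mulrDr => -[k [Uk kE]]; apply: nzr.
    apply: (split_ind _ (\sum_(i < n) (r * u (lift ord0 i) - k i))).
    + exact: UM.
    + exists (fun i => r * u (lift ord0 i) - k i); split=> // i.
      by apply: Us; [apply: UM | apply: Uk].
    + by rewrite sumrB -mulr_sumr addrA kE subrr.
  exists (fun i => r * u (lift ord0 i) - s * v (lift ord0 i)); split.
    by move=> i; apply: Us; apply: UM.
  rewrite !mulrDr eq_rs opprD addrACA subrr add0r sumrB.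
  by rewrite !mulr_sumr.
- apply: IH; first by move=> i; apply: uni.
  move=> u Uu s0 i.
  pose w i := oapp u 0 (unlift ord0 i).
  have := ind w; rewrite big_ord_recl /w /= unlift_none /= => h.
  suff /(_ (lift ord0 i)) : forall i, oapp u 0 (unlift ord0 i) = 0 by rewrite liftK.
  apply: h => [j|]; first by case: unliftP => [l ->|->] //=; apply: Uu.
  by rewrite add0r; under eq_bigr => l _ do rewrite liftK.
Qed.

(** [unlift] puts [y] in front of [x]; the last hypothesis says that [B y] meets the sum of the
    [B x_i] only in zero. *)
Lemma independent_consP n (x : 'I_n -> S) y :
    independent x -> y <> 0 ->
    (forall b r, B b -> (forall i, B (r i)) -> b * y = \sum_i r i * x i -> b * y = 0) ->
  independent (fun i : 'I_n.+1 => oapp x y (unlift ord0 i)).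
Proof.
move=> [nz ind] ny h; split=> [i|r Br].
  by case: unliftP => [j _|_] /=.
rewrite big_ord_recl unlift_none /=.
under eq_bigr => l _ do rewrite liftK.
move=> s0.
have y0 : r ord0 * y = 0.
  apply: (h _ (fun i => - r (lift ord0 i))) => // [i|]; first exact: subringN.
  under eq_bigr => l _ do rewrite mulNr.
  by rewrite sumrN; apply/eqP; rewrite -addr_eq0; apply/eqP.
move: s0; rewrite y0 add0r => /(ind (fun i => r (lift ord0 i))) h0 i.
by case: unliftP => [j ->|->] //=; apply: h0.
Qed.

(** Nonzero elements of the [U i] attain the bound. Any independent family can be multiplied into
    the essential sum, where the chain of length [n] limits its size. *)
Lemma has_udim_max n : has_udim B n -> max_independent n.
Proof.
move=> [U [uni ind ess]]; split.
  have [x hx] := fin_all_exists (fun i => let: And3 _ nz _ := uni i in nz).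
  exists x; split=> [i|].
    by case: (uni i) => [[UB _ _ _] _ _]; apply: UB; case: (hx i).
  split=> [i|r Br s0 i]; first by case: (hx i).
  apply: (ind (fun i => r i * x i)) => // j.
  by case: (uni j) => [[_ _ _ UM] _ _]; apply: UM => //; case: (hx j).
move=> k x Bx indx.
have [r0 hr0] := fin_all_exists (fun i =>
  let: ex_intro2 r Br h := essential_mull ess (Bx i) (indx.1 i) in ex_intro (fun r => B r /\ (r * x i <> 0 /\ family_sum U (r * x i))) r (conj Br h)).
apply: (independent_le_chain (x := fun i => r0 i * x i) (family_sum_chain uni ind)).
  by apply: independent_mull => // i; case: (hr0 i) => [? []].
by move=> i; case: (hr0 i) => [? []].
Qed.

(** By maximality every nonzero [y] in [B] has a nonzero multiple in the span of any [n] independent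
    elements of [B]. For [x] itself this is essentiality; with [x i] replaced by a multiple it
    yields uniformity of [B x_i]. *)
Lemma max_has_udim n : max_independent n -> has_udim B n.
Proof.
move=> [[x [Bx indx]] maxn].
have no_cons (z : 'I_n -> S) y : (forall i, B (z i)) -> B y -> independent z -> y <> 0 ->
   exists b r, [/\ B b, (forall i, B (r i)), b * y = \sum_i r i * z i & b * y <> 0].
  move=> Bz By indz ny; apply: NNPP => h.
  suff: (n < n)%N by rewrite ltnn.
  apply: (maxn _ (fun i => oapp z y (unlift ord0 i))) => [i|].
    by case: unliftP => [j _|_] /=.
  apply: independent_consP => // b r Bb Br e.
  by apply: NNPP => nb; apply: h; exists b, r.
exists (fun i y => exists2 b, B b & y = b * x i); split.
- move=> i; split; first exact: principal_left_ideal.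
    exists (x i); split; last exact: indx.1.
    by exists 1; [exact: subring1 | rewrite mul1r].
  move=> L1 L2 iL1 iL2 sL1 sL2 [y1 [Ly1 ny1]] [y2 [Ly2 ny2]].
  have [b1 Bb1 y1E] := sL1 _ Ly1; have [b2 Bb2 y2E] := sL2 _ Ly2.
  pose c j := if j == i then b1 else 1.
  have Bc j : B (c j) by rewrite /c; case: eqP => // _; exact: subring1.
  have indz : independent (fun j => c j * x j).
    apply: independent_mull => // j; rewrite /c; case: eqP => [->|_].
      by rewrite -y1E.
    by rewrite mul1r; apply: indx.1.
  have [||b [r [Bb Br e nz]]] := no_cons _ y2 _ _ indz ny2.
  + by move=> j; apply: subringM.
  + by rewrite y2E; apply: subringM.
  exists (b * y2); split=> //; split; last by case: iL2 => _ _ _ h; apply: h.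
  suff -> : b * y2 = r i * y1 by case: iL1 => _ _ _ h; apply: h.
  rewrite y1E.
  (* The difference of two expressions of [b * y2] in the [x j]; independence makes their [i]-th
     terms agree. *)
  pose w j := r j * c j - (if j == i then b * b2 else 0).
  have Bw j : B (w j).
    apply: subring_sub; first exact: subringM.
    by case: eqP => // _; [exact: subringM | exact: subring0].
  have wi : w i * x i = 0.
    apply: (indx.2 w Bw).
    under eq_bigr => j _ do rewrite mulrBl -mulrA.
    rewrite sumrB -e [X in _ - X](bigD1 i) //= eqxx big1 ?addr0.
      by rewrite y2E mulrA subrr.
    by move=> j /negPf->; rewrite mul0r.
  move: wi; rewrite /w /c eqxx mulrBl => /eqP; rewrite subr_eq0 => /eqP wi.
  by rewrite y2E !mulrA.
- move=> u Uu s0.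
  have [r hr] := fin_all_exists (fun i => let: ex_intro2 b Bb h := Uu i
     in ex_intro (fun b => B b /\ u i = b * x i) b (conj Bb h)).
  move=> i; rewrite (hr i).2; apply: (indx.2 r); first by move=> j; case: (hr j).
  by rewrite -[RHS]s0; apply: eq_bigr => j _; rewrite (hr j).2.
move=> L [LB _ _ LM] [y [Ly ny]].
have [b [r [Bb Br e nz]]] := no_cons x y Bx (LB _ Ly) indx ny.
exists (b * y); split=> //; split; first exact: LM.
by exists (fun i => r i * x i); split=> // i; exists (r i).
Qed.

(** The bound is lowered until an independent family attains it. *)
Lemma bounded_finite_udim n :
  (forall k (x : 'I_k -> S), (forall i, B (x i)) -> independent x -> (k <= n)%N) ->
  finite_udim B.
Proof.
elim: n => [|n IH] bnd.
  exists 0; apply: max_has_udim; split=> //.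
  exists (fun i => 0); split=> [i|]; first exact: subring0.
  by split=> [[]|r _ _ []].
case: (classic (exists x : 'I_n.+1 -> S, (forall i, B (x i)) /\ independent x)) => h.
  by exists n.+1; apply: max_has_udim.
apply: IH => k x Bx indx.
have := bnd k x Bx indx; rewrite leq_eqVlt => /orP[/eqP e|//].
by case: h; move: x Bx indx; rewrite e => x Bx indx; exists x.
Qed.

Lemma max_independent_inj n m : max_independent n -> max_independent m -> n = m.
Proof.
move=> [[x [Bx ix]] bn] [[y [By iy]] bm]; apply/eqP; rewrite eqn_leq.
by rewrite (bm _ _ Bx ix) (bn _ _ By iy).
Qed.

(** No nonzero [z] has an essential left annihilator: the nonzero left ideal [B w] meets it only in
    zero. *)
Definition left_nonsingular : Prop :=
  forall z, B z -> z <> 0 ->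
    exists w, [/\ B w, w <> 0 & forall b, B b -> b * w * z = 0 -> b * w = 0].

(* If [lann a] is essential and [a r a <> 0], then [lann (a r a)] is strictly
   larger than [lann a]; iterating contradicts the chain condition. *)
Lemma semiprime_acc_nonsingular :
  is_semiprime B -> acc_lann B -> left_nonsingular.
Proof.
move=> semi acc; apply: NNPP => nns.
pose sing z := [/\ B z, z <> 0 &
  forall w, B w -> w <> 0 -> exists b, [/\ B b, b * w * z = 0 & b * w <> 0]].
have [z0 sz0] : exists z, sing z.
  apply: NNPP => h; apply: nns => z Bz nz; apply: NNPP => h2; apply: h.
  exists z; split=> // w Bw nw; apply: NNPP => h3; apply: h2.
  exists w; split=> // b Bb b0; apply: NNPP => nb; apply: h3.
  by exists b.
have next (p : {z | sing z}) : exists q : {z | sing z},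
    (forall s, s * sval p = 0 -> s * sval q = 0) /\
    (exists s, [/\ B s, s * sval q = 0 & s * sval p <> 0]).
  case: p => a [Ba na sa] /=.
  have [r [Br nr]] : exists r, B r /\ a * r * a <> 0.
    apply: NNPP => h; apply: na; apply: semi => // r Br.
    by apply: NNPP => nr; apply: h; exists r.
  have sq : sing (a * r * a).
    split=> [|//|w Bw nw]; first by apply: subringM => //; apply: subringM.
    have [b [Bb b0 nb]] := sa w Bw nw; exists b; split=> //.
    by rewrite !mulrA b0 !mul0r.
  exists (exist _ _ sq) => /=; split=> [s s0|]; first by rewrite !mulrA s0 !mul0r.
  (* [a * r] is nonzero because [a * r * a] is. The resulting [b] kills [a * r * a] but not [a],
     since [b * (a * r)] is nonzero. *)
  have [||b [Bb b0 nb]] := sa (a * r).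
  - exact: subringM.
  - by move=> h; apply: nr; rewrite h mul0r.
  exists b; split=> //; first by move: b0; rewrite !mulrA.
  by move=> h; apply: nb; rewrite mulrA h mul0r.
pose nx p := sval (constructive_indefinite_description _ (next p)).
have nxP p := svalP (constructive_indefinite_description _ (next p)).
pose q n := iter n nx (exist _ z0 sz0).
have [||N hN] := acc (fun n y => y = sval (q n)).
- by move=> n _ ->; case: (svalP (q n)).
- move=> n y [By hy]; split=> // _ ->.
  by apply: (nxP (q n)).1; apply: hy.
have [s [Bs s0 ns]] := (nxP (q N)).2.
have [|_ h] := hN N.+1 (leqnSn N) s; first by split=> // _ ->.
by apply: ns; apply: h.
Qed.

(* In a nonsingular ring an annihilator is never essential in a larger one, so
   every strict inclusion of annihilators yields a further independent element. *)
Lemma nonsingular_acc n :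
  (forall k (x : 'I_k -> S), (forall i, B (x i)) -> independent x -> (k <= n)%N) ->
  left_nonsingular -> acc_lann B.
Proof.
move=> bnd ns V VB asc; apply: NNPP => nstab.
have mono N m : (N <= m)%N -> forall y, lann B (V N) y -> lann B (V m) y.
  move=> /subnKC <-; elim: (m - N)%N => [|d IH] y; first by rewrite addn0.
  by move=> /IH; rewrite addnS; apply: asc.
have lannM N b y : B b -> lann B (V N) y -> lann B (V N) (b * y).
  move=> Bb [By y0]; split=> [|v Vv]; first exact: subringM.
  by rewrite -mulrA y0 // mulr0.
have ex k : exists N (x : 'I_k -> S), (forall i, lann B (V N) (x i)) /\ independent x.
  elim: k => [|k [N [x [Lx indx]]]].
    by exists 0, (fun=> 0); split=> [[]|] //; split=> [[]|r _ _ []].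
  have [m [y [Nm Ly nLy]]] : exists m y, [/\ (N <= m)%N, lann B (V m) y & ~ lann B (V N) y].
    apply: NNPP => h; apply: nstab; exists N => m Nm y Ly.
    by apply: NNPP => nLy; apply: h; exists m, y.
  have By := Ly.1.
  have [v [Vv nv]] : exists v, V N v /\ y * v <> 0.
    apply: NNPP => h; apply: nLy; split=> // v Vv.
    by apply: NNPP => nv; apply: h; exists v.
  (* The new element is [w * y]. If [b w y] lies in the span of the [x i], then [b w y v = 0]
     because every [x i * v] vanishes, and the choice of [w] gives [b w = 0]. *)
  have [|w [Bw nw hw]] := ns _ _ nv; first by apply: subringM => //; apply: VB Vv.
  exists m, (fun i => oapp x (w * y) (unlift ord0 i)); split.
    move=> i; case: unliftP => [j _|_] /=; first exact: mono (Lx j).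
    exact: lannM.
  apply: independent_consP => // [wy0|b r Bb Br e].
    apply: nw; rewrite -[w]mul1r; apply: hw; first exact: subring1.
    by rewrite mul1r mulrA wy0 mul0r.
  rewrite mulrA hw ?mul0r // -!mulrA (mulrA w) (mulrA b) e mulr_suml big1 // => i _.
  by rewrite -mulrA (Lx i).2 ?mulr0.
have [N [x [Lx indx]]] := ex n.+1.
by have := bnd _ x (fun i => (Lx i).1) indx; rewrite ltnn.
Qed.

End IndependentElements.

(** * Growth and orders on abelian groups *)

(** Bernoulli's inequality [1 + m/n <= (1 + 1/n)^m] with denominators cleared. *)
Lemma leq_bernoulli n m : ((n + m) * n ^ m <= n * n.+1 ^ m)%N.
Proof.
elim: m => [|m IH]; first by rewrite addn0.
rewrite !expnS mulnCA [X in (_ <= X)%N]mulnCA.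
apply: leq_trans (leq_mul (leqnn n.+1) IH).
by rewrite !mulnA leq_mul2r; apply/orP; right; nia.
Qed.

(** For positive [n], [(1 + 1/n)^m] outgrows [(m + 1)^k]: it is at least [2] at [m = n], hence at
    least [2^(2^j)] at [m = n 2^j], where [m + 1 <= 2^(n + j)]. *)
Lemma poly_lt_exp n k : exists m, (n ^ m * m.+1 ^ k < n.+1 ^ m)%N.
Proof.
case: n => [|n]; first by exists 1.
set N := n.+1.
have two : (2 * N ^ N <= N.+1 ^ N)%N.
  have := leq_bernoulli N N; rewrite addnn -muln2 -mulnA leq_pmul2l //.
(* Chosen so that [N + j <= 3 i <= 2^i] and [k < 2^i], whence [(N + j) k < 2^j]. *)
pose i := (N + k + 4)%N; pose j := (i + i)%N.
have hi : (3 * i <= 2 ^ i)%N.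
  rewrite /i addn4; elim: (N + k)%N => // d IH; rewrite expnS; lia.
have hk : (k < 2 ^ i)%N.
  by apply: leq_trans (ltn_expl i (ltnSn 1)); rewrite /i; lia.
have hj : ((N + j) * k < 2 ^ j)%N.
  rewrite /j expnD; apply: leq_ltn_trans (_ : 2 ^ i * k < _)%N.
    by rewrite leq_mul2r; apply/orP; right; apply: leq_trans hi; rewrite /i; lia.
  by rewrite ltn_pmul2l ?expn_gt0.
exists (N * 2 ^ j)%N.
apply: leq_trans (_ : N ^ (N * 2 ^ j) * 2 ^ (2 ^ j) <= _)%N.
  rewrite ltn_pmul2l ?expn_gt0 //.
  apply: leq_ltn_trans (_ : (2 ^ (N + j)) ^ k < _)%N; last by rewrite -expnM ltn_exp2l.
  case: (posnP k) => [->|k0]; first by rewrite !expn0.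
  rewrite leq_exp2r // expnD.
  apply: leq_ltn_trans (leqnn _) _.
  apply: leq_trans (_ : N.+1 * 2 ^ j <= _)%N.
    by rewrite mulSn addnC -addn1 leq_add2l expn_gt0.
  by rewrite leq_mul2r; apply/orP; right; apply: ltn_expl.
by rewrite !expnM -expnMn leq_exp2r ?expn_gt0 // mulnC.
Qed.

(** The candidates are the boxes of sums over [P] with multiplicities at most [m]; adding an element
    of [P] leads into the next box. If each step enlarged the box by a factor [1 + 1/n] or more,
    growth would be exponential, against the bound [(m + 1)^k]. The second conclusion keeps [B]
    inside any submonoid containing [P]. *)
Lemma folner_set (G : zmodType) (P : seq G) (n : nat) :
  exists B : seq G,
    [/\ uniq B,
        (forall T : G -> Prop, T 0 -> (forall g h, T g -> T h -> T (g + h)) ->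
           (forall p, p \in P -> T p) -> forall b, b \in B -> T b)
      & (n * size (undup [seq (b + p)%R | b : G <- B, p : G <- P]) < n.+1 * size B)%N].
Proof.
pose k := size P.
pose pt m (f : {ffun 'I_k -> 'I_m.+1}) := \sum_(i < k) P`_i *+ f i.
pose box m := undup (codom (@pt m)).
have box_lt m : (size (box m) <= m.+1 ^ k)%N.
  by rewrite (leq_trans (size_undup _)) // size_codom card_ffun !card_ord.
have box_add m : {subset [seq b + p | b : G <- box m, p : G <- P] <= box m.+1}.
  move=> _ /allpairsP[[b p] [/= + Pp ->]]; rewrite mem_undup => /codomP[f ->].
  rewrite mem_undup.
  have lt_p : (index p P < k)%N by rewrite index_mem.
  pose i0 := Ordinal lt_p.
  suff -> : @pt m f + p = @pt m.+1 [ffun i => inord (f i + (i == i0))] by apply: codom_f.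
  rewrite /pt.
  under [RHS]eq_bigr => i _.
    rewrite ffunE inordK; last by have := ltn_ord (f i); case: (i == i0); lia.
    rewrite mulrnDr; over.
  rewrite big_split /=; congr (_ + _).
  rewrite (bigD1 i0) //= eqxx mulr1n nth_index // big1 ?addr0 //.
  by move=> i /negPf->; rewrite mulr0n.
have box_T m (T : G -> Prop) : T 0 -> (forall g h, T g -> T h -> T (g + h)) ->
    (forall p, p \in P -> T p) -> forall b, b \in box m -> T b.
  move=> T0 TD TP b; rewrite mem_undup => /codomP[f ->].
  apply: (big_ind T) => // i _; elim: (f i : nat) => [|d IH]; first by rewrite mulr0n.
  by rewrite mulrS; apply: TD => //; apply/TP/mem_nth.
case: (classic (exists m, (n * size (box m.+1) < n.+1 * size (box m))%N)) => [[m hm]|nex].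
  exists (box m); split; [exact: undup_uniq | exact: box_T |].
  apply: leq_ltn_trans hm; rewrite leq_mul2l; apply/orP; right.
  apply: uniq_leq_size; first exact: undup_uniq.
  by move=> g; rewrite mem_undup => /box_add.
have grow m : (n.+1 ^ m <= n ^ m * size (box m))%N.
  elim: m => [|m IH].
    rewrite !expn0 mul1n lt0n size_eq0; apply/eqP => b0.
    have: @pt 0 [ffun=> ord0] \in box 0 by rewrite mem_undup codom_f.
    by rewrite b0.
  rewrite expnS; apply: leq_trans (leq_mul (leqnn _) IH) _.
  rewrite mulnCA expnS -mulnA [X in (_ <= X)%N]mulnCA leq_mul2l.
  apply/orP; right; rewrite leqNgt; apply/negP => h; apply: nex; by exists m.
have [m] := poly_lt_exp n k; rewrite ltnNge => /negP[].
by apply: leq_trans (grow m) _; rewrite leq_mul2l box_lt orbT.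
Qed.

(* The image in [int] orders the group well enough to speak of leading terms;
   only finitely many elements have to be told apart at a time. *)
Lemma nonvanishing_morphism (X : choiceType) (l : seq (GX X)) :
  (forall g, g \in l -> g != 0) ->
  exists phi : GX X -> int, {morph phi : g h / g + h} /\ (forall g, g \in l -> phi g != 0).
Proof.
elim: l => [|g l IH] nz.
  by exists (fun=> 0); split=> // g h; rewrite addr0.
have [|phi [phiD phi_nz]] := IH.
  by move=> h hl; apply: nz; rewrite inE hl orbT.
have [x gx] : exists x : X, coeff x g != 0.
  apply: NNPP => h; have := nz g (mem_head _ _); rewrite -[_ != _]/(~~ _) => /negP[].
  apply/freeg_eqP => x; rewrite coeff0; apply/eqP/negPn/negP => gx.
  by apply: h; exists x.
(* [M] exceeds every [|coeff x h|], so [M * phi h + coeff x h] is nonzero when [phi h] is. If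
   [phi g = 0], the nonzero [coeff x g] remains. *)
pose M : int := 1 + \sum_(h <- g :: l) `|coeff x h|.
have M_gt h : h \in g :: l -> `|coeff x h| < M.
  move=> hl; rewrite /M ltz1D (big_rem _ hl) /= lerDl.
  exact: sumr_ge0.
have M_nz u h : h \in g :: l -> u != 0 -> M * u + coeff x h != 0.
  move=> hl u0; apply/eqP => /eqP; rewrite addr_eq0 => /eqP e.
  have : M <= `|M * u|.
    rewrite normrM ger0_norm; last exact: ltW (le_lt_trans (normr_ge0 _) (M_gt h hl)).
    rewrite ler_peMr //; first exact: ltW (le_lt_trans (normr_ge0 _) (M_gt h hl)).
    by rewrite -gtz0_ge1 normr_gt0.
  by rewrite e normrN leNgt M_gt.
exists (fun h => M * phi h + coeff x h); split=> [h1 h2|h].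
  by rewrite phiD coeffD mulrDr addrACA.
rewrite inE => /orP[/eqP->|hl]; last by apply: M_nz; rewrite ?inE ?hl ?orbT // phi_nz.
have [->|u0] := eqVneq (phi g) 0; first by rewrite mulr0 add0r.
by apply: M_nz; rewrite ?mem_head.
Qed.

Lemma separating_morphism (X : choiceType) (l : seq (GX X)) :
  exists phi : GX X -> int,
    {morph phi : g h / g + h} /\ {in l &, injective phi}.
Proof.
have [|phi [phiD phi_nz]] := @nonvanishing_morphism X
   [seq d <- [seq g - h | g : GX X <- l, h : GX X <- l] | d != 0].
  by move=> g; rewrite mem_filter => /andP[].
exists phi; split=> // g h gl hl e.
apply/eqP; rewrite -subr_eq0; apply/negPn/negP => nz.
have := phi_nz (g - h); rewrite mem_filter nz (allpairs_f (fun g h => g - h)) //.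
move=> /(_ isT) /negP[].
by rewrite -(inj_eq (addIr (phi h))) -phiD subrK e add0r.
Qed.

(** * Coefficients and leading terms *)

Lemma big_uniq_extend (V : nmodType) (I : eqType) (F : I -> V) (l L : seq I) :
    uniq l -> uniq L -> {subset l <= L} -> (forall g, g \notin l -> F g = 0) ->
  \sum_(g <- L) F g = \sum_(g <- l) F g.
Proof.
move=> ul uL sub F0.
rewrite (bigID (mem l)) /= [X in _ + X]big1 ?addr0 => [|g]; last exact: F0.
rewrite -big_filter; apply/perm_big/uniq_perm => //; first exact: filter_uniq.
move=> g; rewrite mem_filter /=; case: (boolP (g \in l)) => // gl.
by rewrite sub.
Qed.

Section Coefficients.
Variables (R S : nzRingType) (X : choiceType).
Variables (alpha : X -> {rmorphism R -> R}) (iota : {rmorphism R -> S}).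
Variable mon : GX X -> S.
Hypothesis laurent : is_skew_laurent alpha iota mon.

Lemma mon0 : mon 0 = 1. Proof. by case: laurent => _ []. Qed.
Lemma monD g h : mon (g + h) = mon g * mon h.
Proof. by case: laurent => _ [_ h0] *; apply: h0. Qed.

Lemma expansion_ex (s : S) : exists p : seq (GX X) * (GX X -> R),
  [/\ uniq p.1, (forall g, (g \in p.1) = (p.2 g != 0))
    & s = \sum_(g <- p.1) iota (p.2 g) * mon g].
Proof.
have [l [c ->]] : exists l c, s = \sum_(g <- l) iota (c g) * mon g.
  by case: laurent => _ _ _ h _; apply: h.
(* [l] may repeat a monomial, each time with the same coefficient. *)
pose c' g := c g *+ count_mem g l.
exists ([seq g <- undup l | c' g != 0], c'); split=> /=.
- exact/filter_uniq/undup_uniq.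
- move=> g; rewrite mem_filter mem_undup; case: eqP => //= c0.
  by apply/negPn/negP => /count_memPn h; apply: c0; rewrite /c' h.
rewrite big_filter -big_undup_iterop_count /= [RHS]big_mkcond /=; apply: eq_bigr => g _.
rewrite -[LHS]/(_ *+ _) -mulrnAl -rmorphMn /= -/(c' g).
by case: eqP => // ->; rewrite rmorph0 mul0r.
Qed.

Definition expansion s := sval (constructive_indefinite_description _ (expansion_ex s)).
Definition supp s := (expansion s).1.
Definition coef s := (expansion s).2.

Lemma supp_uniq s : uniq (supp s).
Proof. by rewrite /supp /expansion; case: constructive_indefinite_description => p []. Qed.
Lemma mem_supp s g : (g \in supp s) = (coef s g != 0).
Proof. by rewrite /supp /coef /expansion; case: constructive_indefinite_description => p []. Qed.
Lemma supp_sum s : s = \sum_(g <- supp s) iota (coef s g) * mon g.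
Proof. by rewrite /supp /coef /expansion; case: constructive_indefinite_description => p []. Qed.

Lemma notin_supp s g : g \notin supp s -> coef s g = 0.
Proof. by rewrite mem_supp negbK => /eqP. Qed.

Lemma supp_sum_extend s L : uniq L -> {subset supp s <= L} ->
  s = \sum_(g <- L) iota (coef s g) * mon g.
Proof.
move=> uL sub; rewrite {1}(supp_sum s); apply/esym/big_uniq_extend => //.
  exact: supp_uniq.
by move=> g /notin_supp->; rewrite rmorph0 mul0r.
Qed.

(** The chosen expansion is the only one: both are written over a common duplicate-free list, where
    freeness applies to the difference. *)
Lemma coef_sumE l (f : GX X -> R) : uniq l -> (forall g, g \notin l -> f g = 0) ->
  forall g, coef (\sum_(g <- l) iota (f g) * mon g) g = f g.
Proof.
move=> ul f0 g; set s := \sum_(g <- l) _.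
pose L := undup (l ++ supp s).
have free : forall g, g \in L -> f g - coef s g = 0.
  case: laurent => _ _ _ _; apply; first exact: undup_uniq.
  under eq_bigr => h _ do rewrite rmorphB mulrBl.
  rewrite sumrB -supp_sum_extend ?undup_uniq //; last first.
    by move=> h hs; rewrite mem_undup mem_cat hs orbT.
  apply/eqP; rewrite subr_eq0; apply/eqP/big_uniq_extend => //; first exact: undup_uniq.
    by move=> h hs; rewrite mem_undup mem_cat hs.
  by move=> h /f0->; rewrite rmorph0 mul0r.
have [gL|] := boolP (g \in L).
  by apply/esym/eqP; rewrite -subr_eq0 free.
by rewrite mem_undup mem_cat negb_or => /andP[/f0-> /notin_supp->].
Qed.

Lemma coefB s t g : coef (s - t) g = coef s g - coef t g.
Proof.
pose L := undup (supp s ++ supp t).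
have subl : {subset supp s <= L} by move=> h hs; rewrite mem_undup mem_cat hs.
have subr : {subset supp t <= L} by move=> h hs; rewrite mem_undup mem_cat hs orbT.
have uL : uniq L := undup_uniq _.
rewrite {1}(supp_sum_extend uL subl) {1}(supp_sum_extend uL subr) -sumrB.
under eq_bigr => h _ do rewrite -mulrBl -rmorphB.
rewrite (coef_sumE (f := fun h => coef s h - coef t h)) // => h hL.
rewrite !notin_supp ?subrr //; first by apply: contra hL; apply: subr.
by apply: contra hL; apply: subl.
Qed.

Lemma coef0 g : coef 0 g = 0.
Proof. by rewrite -(subrr 0) coefB subrr. Qed.
Lemma coefN s g : coef (- s) g = - coef s g.
Proof. by rewrite -sub0r coefB coef0 sub0r. Qed.
Lemma coefD s t g : coef (s + t) g = coef s g + coef t g.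
Proof. by rewrite -[t]opprK coefB coefN !opprK. Qed.
Lemma coef_sum (I : Type) (r : seq I) (F : I -> S) g :
  coef (\sum_(i <- r) F i) g = \sum_(i <- r) coef (F i) g.
Proof. exact: (big_morph (coef^~ g) (fun s t => coefD s t g) (coef0 g)). Qed.

Lemma coefP s t : (forall g, coef s g = coef t g) -> s = t.
Proof.
move=> e; apply/eqP; rewrite -subr_eq0; apply/eqP.
rewrite (supp_sum (s - t)) big1 // => g _.
by rewrite coefB e subrr rmorph0 mul0r.
Qed.

Lemma coef_neq0 s : s <> 0 -> exists g, coef s g <> 0.
Proof.
move=> nz; apply: NNPP => h; apply/nz/coefP => g; rewrite coef0.
by apply: NNPP => ng; apply: h; exists g.
Qed.

Lemma coef_term r g h : coef (iota r * mon g) h = if h == g then r else 0.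
Proof.
have := @coef_sumE [:: g] (fun h => if h == g then r else 0).
rewrite big_seq1 eqxx; apply=> // k; rewrite inE => /negPf->; done.
Qed.

Lemma coef_iota r h : coef (iota r) h = if h == 0 then r else 0.
Proof. by rewrite -coef_term mon0 mulr1. Qed.

Lemma iota_inj : injective iota.
Proof. by move=> a b /(congr1 (coef^~ 0)); rewrite !coef_iota eqxx. Qed.

Lemma term_inj g a b : iota a * mon g = iota b * mon g -> a = b.
Proof. by move=> /(congr1 (coef^~ g)); rewrite !coef_term eqxx. Qed.

(** The property passes to sums of exponents and holds for each variable and, by bijectivity of
    [alpha x], for its inverse; these generate [G_X]. *)
Lemma twist_ex g : exists f : R -> R, forall a, mon g * iota a = iota (f a) * mon g.
Proof.
pose P g := exists f : R -> R, forall a, mon g * iota a = iota (f a) * mon g.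
have P0 : P 0 by exists id => a; rewrite mon0 mulr1 mul1r.
have PD h k : P h -> P k -> P (h + k).
  move=> [f hf] [f' hf']; exists (f \o f') => a.
  by rewrite monD -mulrA hf' mulrA hf mulrA.
have Px x : P << x >> by exists (alpha x) => a; case: laurent => _ _ [h _] _ _; apply: h.
have PNx x : P (- << x >>).
  case: laurent => bij _ [_ h] _ _; have [b _ bK] := bij x.
  by exists b => a; rewrite -{1}[a]bK h.
rewrite -[exists f, _]/(P g) -(freeg_sumE g); apply: (big_ind P) => // x _.
move: (coeff x g) => k; rewrite -[k]intz -freegU_mulz.
have Pn (h : GX X) n : P h -> P (h *+ n).
  by move=> Ph; elim: n => [|n IH]; rewrite ?mulr0n // mulrS; apply: PD.
case: k => n; first by rewrite -pmulrn; apply: Pn.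
by rewrite NegzE mulrNz -mulNrz -pmulrn; apply: Pn.
Qed.

(** The automorphism alpha_tau of [R] for [tau = mon g]; its laws are read off by comparing
    coefficients. *)
Definition twist g := sval (constructive_indefinite_description _ (twist_ex g)).
Lemma mon_iota g a : mon g * iota a = iota (twist g a) * mon g.
Proof. exact: (svalP (constructive_indefinite_description _ (twist_ex g))). Qed.

Lemma twistB g a b : twist g (a - b) = twist g a - twist g b.
Proof.
by apply: (@term_inj g); rewrite -mon_iota !rmorphB mulrBr mulrBl !mon_iota.
Qed.
Lemma twistM g a b : twist g (a * b) = twist g a * twist g b.
Proof.
by apply: (@term_inj g); rewrite -mon_iota !rmorphM mulrA mon_iota -!mulrA mon_iota.
Qed.
Lemma twist0 g : twist g 0 = 0.
Proof. by have := twistB g 0 0; rewrite !subrr. Qed.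
Lemma twistN g a : twist g (- a) = - twist g a.
Proof. by rewrite -sub0r twistB twist0 sub0r. Qed.
Lemma twistDr g a b : twist g (a + b) = twist g a + twist g b.
Proof. by rewrite -[b]opprK twistB twistN !opprK. Qed.
Lemma twist_sum g (I : Type) (r : seq I) (F : I -> R) :
  twist g (\sum_(i <- r) F i) = \sum_(i <- r) twist g (F i).
Proof. exact: (big_morph (twist g) (twistDr g) (twist0 g)). Qed.
Lemma twist_id a : twist 0 a = a.
Proof. by apply: (@term_inj 0); rewrite -mon_iota mon0 mulr1 mul1r. Qed.
Lemma twist_add g h a : twist (g + h) a = twist g (twist h a).
Proof.
apply: (@term_inj (g + h)); rewrite -mon_iota monD -mulrA !mon_iota.
by rewrite mulrA mon_iota mulrA.
Qed.
Lemma twistK g : cancel (twist g) (twist (- g)).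
Proof. by move=> a; rewrite -twist_add addNr twist_id. Qed.
Lemma twistVK g : cancel (twist (- g)) (twist g).
Proof. by move=> a; rewrite -twist_add subrr twist_id. Qed.
Lemma twist_eq0 g a : twist g a = 0 -> a = 0.
Proof. by move=> h; rewrite -(twistK g a) h twist0. Qed.

Lemma coef_term_mul r g t k :
  coef (iota r * mon g * t) k = r * twist g (coef t (k - g)).
Proof.
pose f k := r * twist g (coef t (k - g)).
rewrite -[RHS]/(f k) -(@coef_sumE [seq g + h | h <- supp t] f).
- rewrite big_map {1}[t]supp_sum mulr_sumr; congr (coef _ k); apply: eq_bigr => h _.
  rewrite /f addrAC subrr add0r mulrA -(mulrA (iota r)) mon_iota.
  by rewrite rmorphM monD !mulrA.
- by rewrite map_inj_uniq ?supp_uniq //; apply: addrI.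
move=> h hl; rewrite /f notin_supp ?twist0 ?mulr0 //.
apply: contra hl => hl; apply/mapP; exists (h - g) => //.
by rewrite addrC subrK.
Qed.

Lemma coef_mul s t k :
  coef (s * t) k = \sum_(g <- supp s) coef s g * twist g (coef t (k - g)).
Proof.
rewrite {1}[s]supp_sum mulr_suml coef_sum; apply: eq_bigr => g _.
exact: coef_term_mul.
Qed.

Lemma coef_iota_mul r s g : coef (iota r * s) g = r * coef s g.
Proof. by rewrite -[iota r]mulr1 -mon0 coef_term_mul subr0 twist_id. Qed.

Lemma coef_mon_mul u s g : coef (mon u * s) (u + g) = twist u (coef s g).
Proof.
by rewrite -[mon u]mul1r -(rmorph1 iota) coef_term_mul mul1r addrAC subrr add0r.
Qed.

Lemma coef_mul_term s r u g : coef (s * (iota r * mon u)) (g + u) = coef s g * twist g r.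
Proof.
rewrite {1}[s]supp_sum mulr_suml coef_sum.
have e h : coef (iota (coef s h) * mon h * (iota r * mon u)) (g + u) =
   if h == g then coef s g * twist g r else 0.
  rewrite coef_term_mul coef_term -(inj_eq (addIr h)) subrK [u + h]addrC.
  by rewrite (inj_eq (addIr u)) eq_sym; case: eqP => [->|] //; rewrite twist0 mulr0.
under eq_bigr => h _ do rewrite e.
have [gs|gs] := boolP (g \in supp s); last first.
  rewrite notin_supp // mul0r big_seq big1 // => h hs.
  by case: eqP.
rewrite (bigD1_seq g) ?supp_uniq //= eqxx big1 ?addr0 //.
by move=> h /negPf->.
Qed.

Lemma coef_mul_iota s r g : coef (s * iota r) g = coef s g * twist g r.
Proof. by have := coef_mul_term s r 0 g; rewrite mon0 mulr1 addr0. Qed.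

Definition weak_top (phi : GX X -> int) s g0 := forall g, coef s g <> 0 -> phi g <= phi g0.
Definition strict_top (phi : GX X -> int) s g0 :=
  forall g, coef s g <> 0 -> g != g0 -> phi g < phi g0.

(** If [g + h = g0 + h0] with [g <> g0], then [phi h < phi h0] and [phi g <= phi g0], against
    additivity. Ties in [s] are harmless, so [phi] need only be adapted to [t]. *)
Lemma coef_mul_top (phi : GX X -> int) s t g0 h0 :
    {morph phi : g h / g + h} -> weak_top phi s g0 -> strict_top phi t h0 ->
  coef (s * t) (g0 + h0) = coef s g0 * twist g0 (coef t h0).
Proof.
move=> phiD ts tt; rewrite coef_mul.
have e g : g \in supp s -> coef s g * twist g (coef t (g0 + h0 - g)) =
   if g == g0 then coef s g0 * twist g0 (coef t h0) else 0.
  rewrite mem_supp => /eqP gs; case: (eqVneq g g0) => [->|ne].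
    by rewrite addrAC subrr add0r.
  have [->|/eqP nz] := eqVneq (coef t (g0 + h0 - g)) 0; first by rewrite twist0 mulr0.
  have ne' : g0 + h0 - g != h0 by rewrite subr_eq addrC (inj_eq (addrI h0)) eq_sym.
  have lt_h := tt _ nz ne'; have le_g := ts _ gs.
  have : phi (g0 + h0 - g) + phi g = phi g0 + phi h0 by rewrite -phiD subrK phiD.
  lia.
rewrite big_seq; under eq_bigr => g gs do rewrite e //.
rewrite -big_seq.
have [gs|gs] := boolP (g0 \in supp s); last first.
  rewrite notin_supp // mul0r big_seq big1 // => h hs.
  by case: eqP.
rewrite (bigD1_seq g0) ?supp_uniq //= eqxx big1 ?addr0 //.
by move=> h /negPf->.
Qed.

Lemma weak_top_ex (phi : GX X -> int) s : s <> 0 ->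
  exists2 g0, coef s g0 <> 0 & weak_top phi s g0.
Proof.
move=> /coef_neq0 [g /eqP]; rewrite -mem_supp => gs.
have [g0 g0s max0] : exists2 g0, g0 \in supp s & {in supp s, forall h, phi h <= phi g0}.
  elim: (supp s) g gs => // g1 l IH _ _.
  case: l IH => [|g2 l] IH.
    by exists g1; rewrite ?mem_head // => h; rewrite inE => /eqP->.
  have [g3 g3l mx] := IH g2 (mem_head _ _).
  have [le|lt] := leP (phi g1) (phi g3).
    exists g3; first by rewrite inE g3l orbT.
    by move=> h; rewrite inE => /orP[/eqP->|/mx].
  exists g1; rewrite ?mem_head // => h; rewrite inE => /orP[/eqP->//|/mx le].
  exact: le_trans le (ltW lt).
exists g0; first by apply/eqP; rewrite -mem_supp.
by move=> h /eqP; rewrite -mem_supp; apply: max0.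
Qed.

Lemma strict_top_ex s : s <> 0 -> exists phi g0,
  [/\ {morph phi : g h / g + h}, coef s g0 <> 0 & strict_top phi s g0].
Proof.
move=> nz; have [phi [phiD phi_inj]] := separating_morphism (supp s).
have [g0 nz0 top] := weak_top_ex phi nz; exists phi, g0; split=> // g nzg ne.
rewrite lt_neqAle top // andbT; apply: contra ne => /eqP /phi_inj -> //;
  by rewrite mem_supp; apply/eqP.
Qed.

Lemma strict_top_wtop (phi : GX X -> int) s g0 : strict_top phi s g0 -> weak_top phi s g0.
Proof. by move=> h g nz; have [->//|/(h g nz)/ltW] := eqVneq g g0. Qed.

Section Subring.
Variable T : GX X -> Prop.
Hypothesis submonoidT : is_submonoid T.
Local Notation A := (skew_monoid_subring iota mon T).

Lemma skew_monoid_subringP s : A s <-> forall g, coef s g <> 0 -> T g.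
Proof.
split=> [[l [c [Tl ->]]] g|h]; last first.
  exists (supp s), (coef s); split; last exact: supp_sum.
  by move=> g; rewrite mem_supp => /eqP /h.
rewrite coef_sum; case: (boolP (g \in l)) => [/Tl //|gl []].
rewrite big_seq big1 // => h hl; rewrite coef_term.
by case: eqP => // e; rewrite e hl in gl.
Qed.

Lemma term_subring r g : T g -> A (iota r * mon g).
Proof. by move=> Tg; apply/skew_monoid_subringP => h; rewrite coef_term; case: eqP => // ->. Qed.
Lemma iota_subring r : A (iota r).
Proof. by rewrite -[iota r]mulr1 -mon0; apply/term_subring; case: submonoidT. Qed.

Lemma subring_skew_monoid : subring A.
Proof.
split.
- by rewrite -(rmorph1 iota); apply: iota_subring.
- move=> s t /skew_monoid_subringP hs /skew_monoid_subringP ht.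
  apply/skew_monoid_subringP => g; rewrite coefB => nz.
  case: (classic (coef s g = 0)) => [s0|]; last exact: hs.
  by apply: ht => t0; apply: nz; rewrite s0 t0 subrr.
move=> s t /skew_monoid_subringP hs /skew_monoid_subringP ht.
apply/skew_monoid_subringP => k; rewrite coef_mul => nz.
apply: NNPP => nT; apply: nz; rewrite big_seq big1 // => g.
rewrite mem_supp => /eqP gs.
case: (classic (coef t (k - g) = 0)) => [->|nz]; first by rewrite twist0 mulr0.
by case: nT; rewrite -(subrK g k) addrC; apply: submonoidT.2; [apply: hs | apply: ht].
Qed.

(** * Transfer between the coefficient ring and the monoid subring *)

Lemma coef_mul_term_mul (phi : GX X -> int) s t g0 h0 r u :
    {morph phi : g h / g + h} -> weak_top phi s g0 -> strict_top phi t h0 ->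
  coef (s * (iota r * mon u) * t) (g0 + u + h0) =
  coef s g0 * twist g0 r * twist (g0 + u) (coef t h0).
Proof.
move=> phiD ts tt; rewrite (coef_mul_top phiD _ tt) ?coef_mul_term // => g.
have phiE h : phi (h + u) = phi h + phi u := phiD h u.
rewrite -(subrK u g) coef_mul_term !phiE lerD2r => nz; apply: ts => s0.
by apply: nz; rewrite s0 mul0r.
Qed.

Lemma prime_skew_monoid : is_prime (@full R) -> is_prime A.
Proof.
move=> primeR a b Aa Ab ab0; apply: NNPP => /not_or_and[na nb].
have [phi [h0 [phiD nzh toph]]] := strict_top_ex nb.
have [g0 nzg topg] := weak_top_ex phi na.
have orth r : full r -> coef a g0 * r * twist g0 (coef b h0) = 0.
  (* Passing [g0] twists the middle coefficient, so [twist (- g0) r] comes out as [r]. *)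
  have := coef_mul_term_mul (twist (- g0) r) 0 phiD topg toph.
  by rewrite ab0 ?coef0 ?twistVK ?addr0 // mon0 mulr1; apply: iota_subring.
by case: (primeR _ _ Logic.I Logic.I orth) => // /twist_eq0.
Qed.

Lemma semiprime_skew_monoid :
  is_semiprime (@full R) -> acc_lann (@full R) -> is_semiprime A.
Proof.
move=> semiR accR a Aa a0; apply: NNPP => na.
have [phi [g0 [phiD nz0 top0]]] := strict_top_ex na.
set c := coef a g0.
have Tg0 : T g0 by have /skew_monoid_subringP := Aa; apply.
have Tn n : T (g0 *+ n).
  elim: n => [|n IH]; first by rewrite mulr0n; case: submonoidT.
  by rewrite mulrS; apply: submonoidT.2.
(* The monomial of [g0 *+ k], placed between the two copies of [a], raises the twist to
   [g0 *+ k.+1]. *)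
have orth r k : c * r * twist (g0 *+ k.+1) c = 0.
  have := coef_mul_term_mul (twist (- g0) r) (g0 *+ k) phiD (strict_top_wtop top0) top0.
  by rewrite a0 ?coef0 ?twistVK ?mulrS //; apply: term_subring.
pose V n y := exists2 i, (n <= i)%N & y = twist (g0 *+ i) c.
have [//||N hN] := accR V.
  by move=> n y [_ hy]; split=> // _ [i ni ->]; apply: hy; exists i => //; apply: ltnW.
(* Write [c_i] for [twist (g0 *+ i) c]. Each [c_N r] kills all [c_i] with [i > N], hence by
   stability also [c_N]; so [c_N R c_N = 0]. *)
apply: nz0; rewrite -/c; apply: (@twist_eq0 (g0 *+ N)); apply: semiR => // r _.
have [|_ h] := hN N.+1 (leqnSn N) (twist (g0 *+ N) c * r).
  split=> // _ [i Ni ->].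
  rewrite -(subnKC Ni) addSnnS mulrnDr twist_add -[r](twistVK (g0 *+ N)) -!twistM.
  by rewrite orth twist0.
by apply: h; exists N.
Qed.

(** A witness [w] for the leading coefficient of [z] serves for [z]: if [b w z = 0] with [b w]
    nonzero, the untwisted product of leading coefficients contradicts the choice of [w]. *)
Lemma nonsingular_skew_monoid : left_nonsingular (@full R) -> left_nonsingular A.
Proof.
move=> nsR z Az nz.
have [phi [h0 [phiD nz0 top0]]] := strict_top_ex nz.
have [//|w [_ nw hw]] := nsR _ _ nz0.
exists (iota w); split; first exact: iota_subring.
  by move=> w0; apply/nw/iota_inj; rewrite w0 rmorph0.
move=> b _ bwz; apply: NNPP => nbw.
have [g0 nzg topg] := weak_top_ex phi nbw; apply: nzg.
have := coef_mul_top phiD topg top0; rewrite bwz coef0 coef_mul_iota => e.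
have : twist (- g0) (coef b g0) * w * coef z h0 = 0.
  by apply: (@twist_eq0 g0); rewrite !twistM twistVK.
by move/(hw _ Logic.I)/(congr1 (twist g0)); rewrite twistM twistVK twist0.
Qed.

Lemma acc_lann_coefficients : acc_lann A -> acc_lann (@full R).
Proof.
move=> accA V _ asc.
(* [rann (lann (V n))], which has the same left annihilator as [V n] *)
pose W n y := exists2 x, y = iota x & forall a, lann (@full R) (V n) a -> a * x = 0.
have lannW n a : lann (@full R) (V n) a <-> lann A (W n) (iota a).
  split=> [La|[_ h]]; split=> //; first exact: iota_subring.
    by move=> _ [x -> hx]; rewrite -rmorphM hx // rmorph0.
  move=> v Vv; apply: iota_inj; rewrite rmorphM rmorph0; apply: h.
  by exists v => // b [_]; apply.
have [||N hN] := accA W.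
- by move=> n _ [x -> _]; apply: iota_subring.
- move=> n y [Ay hy]; split=> // _ [x -> hx]; apply: hy; exists x => // a La.
  exact/hx/asc.
by exists N => n Nn y /lannW /(hN n Nn) /lannW.
Qed.

(** A relation over [A] splits into one for each monomial [g], which [twist (- g)] turns into a
    relation over [R]. *)
Lemma independent_iota (I : finType) (x : I -> R) :
  independent (@full R) x -> independent A (iota \o x).
Proof.
move=> [nz ind]; split=> [i /= x0|s As s0 i /=].
  by apply/(nz i)/iota_inj; rewrite x0 rmorph0.
apply: coefP => g; rewrite coef0 coef_mul_iota.
have /(_ i) : forall i, twist (- g) (coef (s i) g) * x i = 0.
  apply: ind => //; apply: (@twist_eq0 g); rewrite twist_sum.
  under eq_bigr => j _ do rewrite twistM twistVK -coef_mul_iota.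
  by rewrite -coef_sum [X in coef X g]s0 coef0.
by move/(congr1 (twist g)); rewrite twistM twistVK twist0.
Qed.

(** * Counting elements of [S] over the image of [R] *)

Definition coefficient_subring (s : S) : Prop := exists r, s = iota r.

Lemma subring_coefficient : subring coefficient_subring.
Proof.
split=> [|_ _ [r ->] [r' ->]|_ _ [r ->] [r' ->]].
- by exists 1; rewrite rmorph1.
- by exists (r - r'); rewrite rmorphB.
- by exists (r * r'); rewrite rmorphM.
Qed.

Section Layers.
Variable E : R -> Prop.
Hypotheses (E0 : E 0) (ED : forall a b, E a -> E b -> E (a - b)).
Hypothesis EM : forall r a, E a -> E (r * a).

(** As a left [R]-module, a direct sum of copies of [E], one for each monomial in [F]. *)
Definition layers (F : seq (GX X)) (s : S) : Prop :=
  forall g, E (coef s g) /\ (g \notin F -> coef s g = 0).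

(** The chain first descends through [K] in the coordinate [t]; once that coordinate is zero, the
    chain of [layers F] takes over. *)
Lemma uniform_chain_cons F t K n m :
    uniform_chain (@full R) n K -> uniform_chain coefficient_subring m (layers F) ->
  uniform_chain coefficient_subring (n + m)
    (fun s => K (coef s t) /\
       forall g, g <> t -> E (coef s g) /\ (g \notin F -> coef s g = 0)).
Proof.
move=> + cF; elim: n K => [|n IH] K.
  move=> K0; apply: uniform_chainS cF => s [/K0 st hs] g.
  by case: (classic (g = t)) => [->|/hs //]; rewrite st.
move=> [K' [K'0 K'M ust cK']].
exists (fun s => K' (coef s t) /\
       forall g, g <> t -> E (coef s g) /\ (g \notin F -> coef s g = 0)); split.
- by rewrite coef0; split=> // g _; rewrite coef0.
- move=> _ s [r ->] [Ks hs]; rewrite coef_iota_mul; split; first exact: K'M.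
  move=> g /hs [Eg Fg]; rewrite coef_iota_mul; split; first exact: EM.
  by move/Fg->; rewrite mulr0.
- move=> x y [Kx hx] [Ky hy] nx ny.
  have nKx : ~ K' (coef x t) by move=> h; apply: nx.
  have nKy : ~ K' (coef y t) by move=> h; apply: ny.
  have [r [s [_ _ nK Kd]]] := ust _ _ Kx Ky nKx nKy.
  exists (iota r), (iota s); split; [by exists r | by exists s | |].
    by rewrite coef_iota_mul => -[].
  rewrite coefB !coef_iota_mul; split=> // g gt.
  have [[Ex Fx] [Ey Fy]] := (hx g gt, hy g gt).
  rewrite coefB !coef_iota_mul; split; first by apply: ED; apply: EM.
  by move=> gF; rewrite Fx // Fy // !mulr0 subrr.
exact: IH.
Qed.

Lemma layers_chain F n : uniform_chain (@full R) n E -> uniq F ->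
  uniform_chain coefficient_subring (n * size F) (layers F).
Proof.
move=> cE; elim: F => [_|t F IH] /=.
  by rewrite muln0 => s hs; apply: coefP => g; rewrite coef0; apply: (hs g).2.
move=> /andP[tF /IH cF]; rewrite mulnS.
apply: uniform_chainS (uniform_chain_cons t cE cF) => s hs; split; first exact: (hs t).1.
move=> g /eqP gt; have [Eg Fg] := hs g; split=> // gF; apply: Fg.
by rewrite inE negb_or gt.
Qed.

(** The coefficients are moved into [E] one at a time; those already there stay, as [E] absorbs left
    multiplication. *)
Lemma essential_layers : essential_left_ideal (@full R) E -> forall s, s <> 0 ->
  exists r, iota r * s <> 0 /\ forall g, E (coef (iota r * s) g).
Proof.
move=> ess s nz.
have ful : subring (@full R) by [].
suff [r [nr hr]] : exists r, iota r * s <> 0 /\ {in supp s, forall g, E (coef (iota r * s) g)}.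
  exists r; split=> // g; have [/hr//|/notin_supp s0] := boolP (g \in supp s).
  by rewrite coef_iota_mul s0 mulr0.
elim: (supp s) => [|g l [r [nr hr]]].
  by exists 1; rewrite rmorph1 mul1r.
case: (classic (coef (iota r * s) g = 0)) => [c0|nc].
  by exists r; split=> // h; rewrite inE => /orP[/eqP->|/hr //]; rewrite c0.
have [r' _ [nr' Er']] := essential_mull ful ess (Logic.I : full _) nc.
have rE : iota (r' * r) * s = iota r' * (iota r * s) by rewrite rmorphM mulrA.
exists (r' * r); rewrite rE; split.
  by move=> h; apply: nr'; rewrite -coef_iota_mul h coef0.
move=> h; rewrite coef_iota_mul inE => /orP[/eqP->//|/hr]; exact: EM.
Qed.

End Layers.

(* Holds for elements of minimal support among the multiples of a given element. *)
Definition balanced (a : S) : Prop :=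
  forall r h, coef a h <> 0 -> r * coef a h = 0 -> iota r * a = 0.

Lemma size_supp_lt s t g : (forall h, coef s h <> 0 -> coef t h <> 0) ->
  coef s g = 0 -> coef t g <> 0 -> (size (supp s) < size (supp t))%N.
Proof.
move=> sub sg tg; rewrite -[(size (supp s)).+1]/(size (g :: supp s)).
apply: uniq_leq_size => /=; first by rewrite supp_uniq mem_supp sg eqxx.
move=> h; rewrite inE => /orP[/eqP->|]; rewrite !mem_supp; first exact/eqP.
by move/eqP/sub/eqP.
Qed.

(** If [balanced] fails, some [r] kills a nonzero coefficient of [a] but not [a], and [iota r * a]
    has smaller support. *)
Lemma balanced_ex a : a <> 0 -> exists b, [/\ A b, b * a <> 0 & balanced (b * a)].
Proof.
have [m] := ubnP (size (supp a)); elim: m a => // m IH a; rewrite ltnS => sz na.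
case: (classic (balanced a)) => [bal|].
  by exists 1; rewrite mul1r; split=> //; rewrite -(rmorph1 iota); apply: iota_subring.
move=> /not_all_ex_not [r] /not_all_ex_not [h] nbal.
have [nh r0 nr] : [/\ coef a h <> 0, r * coef a h = 0 & iota r * a <> 0] by split; tauto.
have [||b [Ab nb bal]] := IH (iota r * a).
- apply: leq_trans sz; apply: (@size_supp_lt _ _ h) => //; last by rewrite coef_iota_mul.
  by move=> g; rewrite coef_iota_mul => ng g0; apply: ng; rewrite g0 mulr0.
- exact: nr.
exists (b * iota r); rewrite -mulrA; split=> //.
have [_ _ AM] := subring_skew_monoid; apply: AM => //; exact: iota_subring.
Qed.

(** The leading coefficient of [s], untwisted, kills that of [a], hence [a] itself by balance. So
    the leading term of [s] kills [a] and can be split off. *)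
Lemma balanced_ann a s : balanced a -> s * a = 0 ->
  forall g, iota (coef s g) * mon g * a = 0.
Proof.
move=> bal; case: (classic (a = 0)) => [->|na]; first by move=> _ g; rewrite mulr0.
have [phi [h0 [phiD nzh toph]]] := strict_top_ex na.
have [m] := ubnP (size (supp s)); elim: m s => // m IH s; rewrite ltnS => sz sa0 g.
case: (classic (s = 0)) => [->|ns]; first by rewrite coef0 rmorph0 !mul0r.
have [g0 nzg topg] := weak_top_ex phi ns.
set u := iota (coef s g0) * mon g0.
have ua0 : u * a = 0.
  have := coef_mul_top phiD topg toph; rewrite sa0 coef0 => e.
  rewrite /u -[coef s g0](twistVK g0) -mon_iota -mulrA (bal _ h0) ?mulr0 //.
  by apply: (@twist_eq0 g0); rewrite twistM twistVK.
have cE h : coef (s - u) h = if h == g0 then 0 else coef s h.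
  by rewrite coefB coef_term; case: eqP => [->|_]; rewrite ?subrr ?subr0.
case: (eqVneq g g0) => [->//|ne].
have := IH (s - u); rewrite mulrBl sa0 ua0 subrr => /(_ _ erefl g).
rewrite cE (negPf ne); apply; apply: leq_trans sz.
apply: (@size_supp_lt _ _ g0) => //; last by rewrite cE eqxx.
by move=> h; rewrite cE; case: eqP.
Qed.

(* With [x i] balanced, the elements [mon b * x i], [b] in [B], are independent
   over [R], and they lie in a free module of rank less than [(1 + 1/n) |B|]. *)
Lemma independent_skew_monoid_le n : has_udim (@full R) n ->
  forall k (x : 'I_k -> S), (forall i, A (x i)) -> independent A x -> (k <= n)%N.
Proof.
move=> [U [uni indU ess]] k x Ax indx.
have ful : subring (@full R) by [].
have sA := subring_skew_monoid; have sI := subring_coefficient.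
have cE := family_sum_chain ful uni indU.
set E := family_sum U in cE ess.
have Ui i : left_ideal (@full R) (U i) by case: (uni i).
have E0 : E 0 by exists (fun=> 0); split=> [i|]; [case: (Ui i) | rewrite big1].
have ED a b : E a -> E b -> E (a - b).
  move=> [u [Uu ->]] [v [Uv ->]]; exists (fun i => u i - v i); rewrite sumrB; split=> // i.
  by case: (Ui i) => _ _ h _; apply: h.
have EM r a : E a -> E (r * a).
  move=> [u [Uu ->]]; exists (fun i => r * u i); rewrite mulr_sumr; split=> // i.
  by case: (Ui i) => _ _ _ h; apply: h.
have [b hb] := fin_all_exists (fun i => balanced_ex (indx.1 i)).
pose a i := b i * x i.
have Aa i : A (a i) by apply: (subringM sA); [case: (hb i) | apply: Ax].
have inda : independent A a.
  by apply: independent_mull => // i; case: (hb i).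
pose P := flatten [seq supp (a i) | i <- enum 'I_k].
have memP i g : g \in supp (a i) -> g \in P.
  by move=> gs; apply/flattenP; exists (supp (a i)) => //; apply: map_f; rewrite mem_enum.
have TP p : p \in P -> T p.
  move=> /flattenP[_ /mapP[i _ ->]]; rewrite mem_supp => /eqP.
  by have /skew_monoid_subringP h := Aa i; apply: h.
have [B [uB TB ltB]] := folner_set P n.
have {}TB g : g \in B -> T g by apply: TB => //; case: submonoidT.
set F := undup _ in ltB.
pose y (p : 'I_k * 'I_(size B)) := mon (nth 0 B p.2) * a p.1.
have indy : independent coefficient_subring y.
  split=> [[i j] y0|r Ir r0].
    apply: (inda.1 i); rewrite -[a i]mul1r -mon0 -(addNr (nth 0 B j)) monD -mulrA.
    by rewrite [_ * a i]y0 mulr0.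
  have [rho rE] := fin_all_exists Ir.
  (* The terms of the relation with the same [i] are gathered into [s i]. Independence over [A]
     gives [s i * a i = 0], and [balanced_ann] separates the monomials. *)
  pose s i := \sum_(j < size B) iota (rho (i, j)) * mon (nth 0 B j).
  have As i : A (s i).
    by apply: subring_sum => // j; apply: term_subring; apply/TB/mem_nth.
  have coef_s i (j : 'I_(size B)) : coef (s i) (nth 0 B j) = rho (i, j).
    rewrite /s coef_sum (bigD1 j) //= coef_term eqxx big1 ?addr0 // => l lj.
    by rewrite coef_term nth_uniq // -val_eqE eq_sym in lj *; rewrite (negPf lj).
  have sa i : s i * a i = 0.
    apply: inda.2 => //; rewrite -[RHS]r0 [RHS](eq_bigr
      (fun p => iota (rho (p.1, p.2)) * mon (nth 0 B p.2) * a p.1)).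
      rewrite -(pair_bigA _ (fun i j => iota (rho (i, j)) * mon (nth 0 B j) * a i)) /=.
      by apply: eq_bigr => l _; rewrite mulr_suml.
    by move=> [l j] _ /=; rewrite rE /y mulrA.
  move=> [i j]; rewrite rE /y /= mulrA -coef_s; apply: balanced_ann => //.
  by case: (hb i).
have Fy p g : g \notin F -> coef (y p) g = 0.
  case: p => i j gF; apply/eqP; apply: contraR gF => nz; rewrite mem_undup.
  rewrite -(subrK (nth 0 B j) g) addrC.
  apply: (allpairs_f (fun b p => b + p)); first exact: mem_nth.
  apply: (memP i); rewrite mem_supp; apply: contra nz => /eqP c0.
  rewrite /y /= -{1}(subrK (nth 0 B j) g) addrC coef_mon_mul c0 twist0; exact/eqP.
(* Nonzero multiples with all coefficients in [E] lie in [layers E F], which has a chain of length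
   [n * size F]. *)
have [r hr] := fin_all_exists (fun p => essential_layers E0 EM ess (indy.1 p)).
have indry : independent coefficient_subring (fun p => iota (r p) * y p).
  apply: independent_mull => // p; first by exists (r p).
  by case: (hr p).
have le_kB := independent_le_chain sI (layers_chain E0 ED EM cE (undup_uniq _))
  (independent_ord indry).
have : (k * size B <= n * size F)%N.
  rewrite -[k in X in (X <= _)%N]card_ord -[size B]card_ord -card_prod; apply: le_kB.
  move=> p g; split; first by case: (hr (enum_val p)).
  by move=> gF; rewrite coef_iota_mul Fy // mulr0.
move=> /leq_ltn_trans /(_ ltB); rewrite ltn_mul2r => /andP[_]; by rewrite ltnS.
Qed.

Lemma has_udim_skew_monoid n : has_udim (@full R) n -> has_udim A n.
Proof.
move=> uR; have ful : subring (@full R) by [].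
apply: max_has_udim; first exact: subring_skew_monoid.
split; last exact: independent_skew_monoid_le.
have [[x [_ indx]] _] := has_udim_max ful uR.
exists (iota \o x); split; last exact: independent_iota.
by move=> i; apply: iota_subring.
Qed.

Lemma left_goldie_skew_monoid : is_semiprime (@full R) ->
  left_goldie (@full R) -> left_goldie A.
Proof.
move=> semiR [[n uR] accR]; split; first by exists n; apply: has_udim_skew_monoid.
apply: (nonsingular_acc subring_skew_monoid (independent_skew_monoid_le uR)).
by apply/nonsingular_skew_monoid/semiprime_acc_nonsingular.
Qed.

Lemma left_goldie_coefficients : left_goldie A -> left_goldie (@full R).
Proof.
move=> [[n uA] accA]; split; last exact: acc_lann_coefficients.
have [_ bnd] := has_udim_max subring_skew_monoid uA.
apply: (@bounded_finite_udim _ _ _ n) => // k x _ /independent_iota indx.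
by apply: bnd indx => i; apply: iota_subring.
Qed.

(** The dimension of [R] is also one of [A], and that of [A] is unique. *)
Lemma has_udim_skew_monoidE n : finite_udim (@full R) ->
  has_udim A n <-> has_udim (@full R) n.
Proof.
move=> [m uR]; split=> [uA|]; last exact: has_udim_skew_monoid.
have sA := subring_skew_monoid.
by rewrite (max_independent_inj (has_udim_max sA uA)
  (has_udim_max sA (has_udim_skew_monoid uR))).
Qed.

End Subring.
End Coefficients.


Theorem mainTheorem7 (R S : nzRingType) (X : choiceType)
    (alpha : X -> {rmorphism R -> R}) (iota : {rmorphism R -> S})
    (mon : GX X -> S) (T : GX X -> Prop) :
  is_skew_laurent alpha iota mon ->
  is_submonoid T ->
  let A := skew_monoid_subring iota mon T in
  (is_prime (@full R) ->
     (left_goldie (@full R) <-> left_goldie A) /\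
     (left_goldie (@full R) ->
        is_prime A /\ (forall n, has_udim A n <-> has_udim (@full R) n))) /\
  (is_semiprime (@full R) ->
     (left_goldie (@full R) <-> left_goldie A) /\
     (left_goldie (@full R) ->
        is_semiprime A /\ (forall n, has_udim A n <-> has_udim (@full R) n))).
Proof.
move=> laurent submonoidT A.
have goldieE : is_semiprime (@full R) -> left_goldie (@full R) <-> left_goldie A.
  move=> semiR; split; first exact: (left_goldie_skew_monoid laurent).
  exact: (left_goldie_coefficients laurent).
split=> primeR; split.
- by apply: goldieE => a _ a0; case: (primeR a a).
- move=> [uR _]; split; first exact: (prime_skew_monoid laurent).
  by move=> n; apply: (has_udim_skew_monoidE laurent).
- exact: goldieE.
move=> [uR accR]; split; first exact: (semiprime_skew_monoid laurent).
by move=> n; apply: (has_udim_skew_monoidE laurent).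
Qed.
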